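(* Let $Q$ be a groupoid with a left neutral element $1$ and left inverses, that is, $1\cdot x = x$ for every $x\in Q$, and for every $x\in Q$ there is $x'\in Q$ with $x'\cdot x = 1$. Suppose that $Q$ satisfies one of the following identities (for all $x,y,z\in Q$): (LB) $(x\cdot (y\cdot x))\cdot z = x\cdot (y\cdot (x\cdot z))$; (M1) $((x\cdot y)\cdot x)\cdot z = x\cdot (y\cdot (x\cdot z))$; (M2) $x\cdot (y\cdot (z\cdot y)) = ((x\cdot y)\cdot z)\cdot y$; (C) $x\cdot (y\cdot (y\cdot z)) = ((x\cdot y)\cdot y)\cdot z$. Then $Q$ is a loop.
   Context: A groupoid here is a set with a single binary operation $\cdot$ (no further axioms). A loop is a groupoid with a two-sided neutral element in which every equation $x\cdot y = z$ has a unique solution whenever two of the elements $x,y,z$ are specified; equivalently, there is a two-sided neutral element and all left translations $y\mapsto x\cdot y$ and all right translations $y\mapsto y\cdot x$ are bijections. *)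

(* Defs.v *)
From mathcomp Require Import all_boot.

Set Implicit Arguments.
Unset Strict Implicit.
Unset Printing Implicit Defensive.

Local Open Scope group_scope.

(* A groupoid (a set with one binary operation) is a [magmaType].  In
   [is_loop], the equation x * y = z with x and y specified needs no clause,
   since the operation is a total function. *)
Definition is_loop (Q : magmaType) : Prop :=
  exists e : Q,
    [/\ left_id e (@mul Q),
        right_id e (@mul Q),
        forall x z : Q, exists! y : Q, x * y = z
      & forall y z : Q, exists! x : Q, x * y = z].

Definition idLB (Q : magmaType) : Prop :=
  forall x y z : Q, (x * (y * x)) * z = x * (y * (x * z)).

Definition idM1 (Q : magmaType) : Prop :=
  forall x y z : Q, ((x * y) * x) * z = x * (y * (x * z)).

Definition idM2 (Q : magmaType) : Prop :=
  forall x y z : Q, x * (y * (z * y)) = ((x * y) * z) * y.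

Definition idC (Q : magmaType) : Prop :=
  forall x y z : Q, x * (y * (y * z)) = ((x * y) * y) * z.

(* Main.v *)
Require Import Defs.
From mathcomp Require Import all_boot.

(** Write [L x] and [R x] for the translations y |-> x * y and y |-> y * x.  Each
    identity says that certain composites of translations are again
    translations, say L w or R w; call [w] the index of the composite.  Since
    L e is the identity, a composite of left translations with index [e] is the
    identity, and so its last factor is injective and its first surjective.
    The work lies in finding such composites while [e] is only left neutral and
    inverses are only left inverses.

    Throughout, [a * x = e] and [b * a = e].

    - (LB) and (M1).  The indices x (y x) and (x y) x cannot be compared
      directly, but both identities imply that L x L y L x has the index
      x (y (x e)) ([LB_sandwich], [M1_sandwich]) and that
      L x L a L x = L x ([LB_regular], [M1_regular]).  These two facts are enough:
      replacing [a] by [a * e] one may take [a * e = a], and then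
      L a L b L b L a = L e = id.  So L a is bijective with inverse L b, which
      forces x = b e and L x = L b ([sandwich_left_inverses]).  Once [e] is
      neutral, the sandwich identity is (LB) itself, and it determines L w from
      w x, which inverts the right translations ([sandwich_is_loop]).

    - (M2).  The element b (a (x a)) equals both x a and b a, so inverses are
      two-sided and [e] is right neutral.  Then R x R (a a) R x = id, and R x
      has inverse R a.  Surjectivity of R x turns a (x (z x)) = z x into
      L a L x = id ([M2_is_loop]).

    - (C).  In a chain c b = b a = a x = e, the translations L a and L c
      agree, so a b = c b = e ([C_inv_sym]).  Moreover L u = id as soon as
      u e = e, and L a L b has such an index u, so L a L b = id
      ([C_inverse_cancel]).  This makes [e] right neutral, and (C) then also
      gives (u a) x = u ([C_is_loop]). *)

Set Implicit Arguments.
Unset Strict Implicit.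
Unset Printing Implicit Defensive.

Local Open Scope group_scope.

(** * Loops and bijective translations *)

Lemma bijective_exists_unique (A B : Type) (f : A -> B) :
  bijective f -> forall z, exists! y, f y = z.
Proof.
by case=> g fK gK z; exists (g z); split=> [|y <-]; [exact: gK | exact: fK].
Qed.

Lemma is_loop_bijective (Q : magmaType) (e : Q) :
  left_id e (@mul Q) -> right_id e (@mul Q) ->
  (forall x : Q, bijective (fun y => x * y)) ->
  (forall x : Q, bijective (fun y => y * x)) ->
  is_loop Q.
Proof.
move=> mul1x mulx1 Lbij Rbij; exists e; split=> //.
- by move=> x; exact: bijective_exists_unique (Lbij x).
- by move=> x; exact: bijective_exists_unique (Rbij x).
Qed.

(** When [e] is neutral, a law [a * (x * z) = z] for every pair [a * x = e]
    is already the two-sided inverse property: for [b * a = e], the law gives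
    [x = b * (a * x) = b * e = b], so [a] and [x] may be exchanged. *)
Lemma left_inverse_property_bijective (Q : magmaType) (e : Q) :
  left_id e (@mul Q) -> right_id e (@mul Q) ->
  (forall x : Q, exists a, a * x = e) ->
  (forall a x z : Q, a * x = e -> a * (x * z) = z) ->
  forall x : Q, exists a, [/\ a * x = e, x * a = e,
    forall z, a * (x * z) = z & forall z, x * (a * z) = z].
Proof.
move=> mul1x mulx1 inv lip x.
have [a ax] := inv x; have [b ba] := inv a.
have xb : x = b by rewrite -(lip b a x ba) ax mulx1.
have xa : x * a = e by rewrite xb.
by exists a; split=> // z; apply: lip.
Qed.

(** * The identities (LB) and (M1) *)

Definition L_sandwich (Q : magmaType) (e : Q) :=
  forall x y z : Q, (x * (y * (x * e))) * z = x * (y * (x * z)).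

Definition L_regular (Q : magmaType) (e : Q) :=
  forall a x z : Q, a * x = e -> x * (a * (x * z)) = x * z.

(** The sandwich identity at [x = e] says that right multiplication by [e]
    does not change the left translation. *)
Lemma L_sandwich_mule (Q : magmaType) (e : Q) :
  left_id e (@mul Q) -> L_sandwich e -> forall y z : Q, (y * e) * z = y * z.
Proof. by move=> mul1x sw y z; have := sw e y z; rewrite !mul1x. Qed.

Lemma LB_mule (Q : magmaType) (e : Q) :
  left_id e (@mul Q) -> idLB Q -> forall y z : Q, (y * e) * z = y * z.
Proof. by move=> mul1x LB y z; have := LB e y z; rewrite !mul1x. Qed.

Lemma M1_mule (Q : magmaType) (e : Q) :
  left_id e (@mul Q) -> idM1 Q -> forall y z : Q, (y * e) * z = y * z.
Proof. by move=> mul1x M1 y z; have := M1 e y z; rewrite !mul1x. Qed.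

(** Replacing the index [w] of a left translation by [w * e] brings the two
    different indices in (LB) and (M1) to the common form [x * (y * (x * e))]. *)
Lemma LB_sandwich (Q : magmaType) (e : Q) :
  left_id e (@mul Q) -> idLB Q -> L_sandwich e.
Proof.
by move=> mul1x LB x y z; rewrite -(LB x y e) (LB_mule mul1x LB) LB.
Qed.

Lemma M1_sandwich (Q : magmaType) (e : Q) :
  left_id e (@mul Q) -> idM1 Q -> L_sandwich e.
Proof.
by move=> mul1x M1 x y z; rewrite -(M1 x y e) (M1_mule mul1x M1) M1.
Qed.

Lemma LB_regular (Q : magmaType) (e : Q) :
  left_id e (@mul Q) -> idLB Q -> L_regular e.
Proof.
by move=> mul1x LB a x z ax; rewrite -LB ax (LB_mule mul1x LB).
Qed.

(** (M1) gives regularity directly only with [a] and [x] exchanged, since the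
    index of L a L x L a is [(a * x) * a = a].  Evaluating that at [x] gives
    [a * (x * e) = e], which makes the sandwich index of L x L a L x
    equal to [x * e]. *)
Lemma M1_regular (Q : magmaType) (e : Q) :
  left_id e (@mul Q) -> idM1 Q -> L_regular e.
Proof.
move=> mul1x M1 a x z ax.
have axe : a * (x * e) = e by rewrite -{1}ax -M1 ax mul1x ax.
by rewrite -(M1_sandwich mul1x M1) axe (M1_mule mul1x M1).
Qed.

(** For a left inverse [a] of [x] with [a * e = a], and [b * a = e], regularity
    gives L a L b L a = L a; the missing fact is that L a is bijective.  It is
    both ends of L a L y L a with [y = b * (b * e)], where L y = L b L b, and the
    index of this composite is [a * (y * (a * e)) = a * (b * e) = e]. *)
Lemma sandwich_left_inverses (Q : magmaType) (e : Q) :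
  left_id e (@mul Q) -> (forall x : Q, exists a, a * x = e) ->
  L_sandwich e -> L_regular e ->
  right_id e (@mul Q) /\
  (forall a x z : Q, a * x = e -> a * (x * z) = z).
Proof.
move=> mul1x inv sw reg.
have mule := L_sandwich_mule mul1x sw.
(* A left inverse [a] with [a * e = a] suffices: [a * e] always is one. *)
have norm (a x : Q) : a * e = a -> a * x = e ->
    x * e = x /\ forall z, a * (x * z) = z.
  move=> ae ax; have [b ba] := inv a.
  have abe : a * (b * e) = e by rewrite -ax (reg b a).
  have bb z : (b * (b * e)) * z = b * (b * z).
    by have := sw b e z; rewrite !mul1x.
  have abba z : a * (b * (b * (a * z))) = z.
    rewrite -bb -(sw a (b * (b * e)) z).
    by rewrite bb ae ba abe mul1x.
  have La_inj : injective (fun z => a * z).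
    by move=> u v /= auv; rewrite -(abba u) auv abba.
  have xbe : x = b * e by apply: La_inj; rewrite /= abe.
  split=> [|z]; first by rewrite xbe mule.
  by rewrite xbe mule -{1}(abba z) (reg b a) // abba.
split=> [x|a x z ax].
  have [a ax] := inv x.
  by case: (@norm (a * e) x) => //; rewrite mule.
rewrite -mule.
by case: (@norm (a * e) x) => //; rewrite mule.
Qed.

(** With neutral [e] the sandwich identity is (LB).  If [w * x = z], it reads
    L x L w L x = L (x z), so [w = a * ((x * z) * a)] with [a] inverse to [x]. *)
Lemma sandwich_is_loop (Q : magmaType) (e : Q) :
  left_id e (@mul Q) -> (forall x : Q, exists a, a * x = e) ->
  L_sandwich e -> L_regular e -> is_loop Q.
Proof.
move=> mul1x inv sw reg.
have [mulx1 lip] := sandwich_left_inverses mul1x inv sw reg.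
have invs := left_inverse_property_bijective mul1x mulx1 inv lip.
have LB (x y z : Q) : (x * (y * x)) * z = x * (y * (x * z)).
  by rewrite -sw mulx1.
apply: (is_loop_bijective mul1x mulx1) => x; have [a [ax xa axK xaK]] := invs x.
  by exists (fun z => a * z) => z.
exists (fun z => a * ((x * z) * a)) => z.
  by rewrite LB axK xa mulx1.
by rewrite LB ax mulx1 axK.
Qed.

(** * The identity (M2) *)

Lemma M2_is_loop (Q : magmaType) (e : Q) :
  left_id e (@mul Q) -> (forall x : Q, exists a, a * x = e) ->
  idM2 Q -> is_loop Q.
Proof.
move=> mul1x inv M2.
have flex (y z : Q) : y * (z * y) = (y * z) * y.
  by have := M2 e y z; rewrite !mul1x.
have lip_image (a x z : Q) : a * x = e -> a * (x * (z * x)) = z * x.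
  by move=> ax; rewrite M2 ax mul1x.
have inv_sym (a x : Q) : a * x = e -> x * a = e.
  move=> ax; have [b ba] := inv a.
  by rewrite -(lip_image b a x ba) flex ax mul1x.
have mulx1 : right_id e (@mul Q).
  move=> x; have [a ax] := inv x.
  by rewrite -{1}ax flex (inv_sym _ _ ax) mul1x.
have mulyy (u y : Q) : u * (y * y) = (u * y) * y.
  by have := M2 u y e; rewrite mul1x mulx1.
have sandwich_id (a x u : Q) : a * x = e -> ((u * x) * (a * a)) * x = u.
  move=> ax; rewrite -M2 flex mulyy (inv_sym _ _ ax).
  by rewrite mul1x ax mulx1.
have rip (a x u : Q) : a * x = e -> (u * a) * x = u.
  move=> ax; rewrite -{1}(sandwich_id _ _ u ax) -M2 ax mulx1.
  exact: sandwich_id.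
have lip (a x z : Q) : a * x = e -> a * (x * z) = z.
  by move=> ax; rewrite -(rip a x z ax) lip_image.
have invs := left_inverse_property_bijective mul1x mulx1 inv lip.
apply: (is_loop_bijective mul1x mulx1) => x; have [a [ax xa axK xaK]] := invs x.
  by exists (fun z => a * z) => z.
by exists (fun z => z * a) => z; apply: rip.
Qed.

(** * The identity (C) *)

(** In the chain [c * b = e], [b * a = e], [a * x = e], the elements [c] and [a]
    have the same left translation, because [c * e] and [a * e] are both equal
    to [c * (b * (a * e))], and (C) gives L ((y e) e) = L y.
    Hence [a * b = c * b = e]. *)
Lemma C_inv_sym (Q : magmaType) (e : Q) :
  left_id e (@mul Q) -> (forall x : Q, exists a, a * x = e) ->
  idC Q -> forall a b x : Q, b * a = e -> a * x = e -> a * b = e.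
Proof.
move=> mul1x inv C a b x ba ax; have [c cb] := inv b.
have mulee (y z : Q) : ((y * e) * e) * z = y * z.
  by have := C y e z; rewrite !mul1x.
have absorb (u y z : Q) : u * y = e -> u * (y * (y * z)) = y * z.
  by move=> uy; rewrite C uy mul1x.
have bae : b * (a * e) = e by rewrite -ax absorb.
have cba : c * (b * (a * e)) = a * e.
  by rewrite -(absorb b a e ba) absorb.
by rewrite -mulee -cba bae mulee.
Qed.

(** An element [u] with [u * e = e] satisfies L u = id, by (C) at [y = e].  The
    index of L (a a) L b L b = L a L a L b L b = L a L b is such a [u], so that
    [a * (b * z) = z]. *)
Lemma C_inverse_cancel (Q : magmaType) (e : Q) :
  left_id e (@mul Q) -> idC Q ->
  forall a b : Q, a * b = e -> b * a = e -> forall z, a * (b * z) = z.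
Proof.
move=> mul1x C a b ab ba z.
have L_id (u t : Q) : u * e = e -> u * t = t.
  by move=> ue; have := C u e t; rewrite !mul1x ue !mul1x.
have abb (t : Q) : a * (b * (b * t)) = b * t by rewrite C ab mul1x.
have lalt (t : Q) : (a * a) * t = a * (a * t).
  by have := C e a t; rewrite !mul1x.
have uE (t : Q) : (((a * a) * b) * b) * t = a * (b * t).
  by rewrite -C lalt abb.
by rewrite -uE L_id // uE -{1}ba abb.
Qed.

(** Left translations are inverted by [C_inverse_cancel].  For right translations,
    evaluate [((u * a) * a) * (x * x)] in two ways when [a] and [x] are inverse:
    it is [u * (a * (a * (x * x))) = u] by (C), and it is
    [(((u * a) * a) * x) * x = (u * a) * x] since [((u * a) * a) * x = u * a]. *)
Lemma C_is_loop (Q : magmaType) (e : Q) :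
  left_id e (@mul Q) -> (forall x : Q, exists a, a * x = e) ->
  idC Q -> is_loop Q.
Proof.
move=> mul1x inv C.
have inv_sym (a x : Q) : a * x = e -> x * a = e.
  move=> ax; have [b ba] := inv a.
  have ab := C_inv_sym mul1x inv C ba ax.
  have cancel := C_inverse_cancel mul1x C ba ab.
  suff -> : x = b by [].
  by rewrite -(cancel x) ax -ab cancel.
have lip (a x z : Q) : a * x = e -> a * (x * z) = z.
  by move=> ax; apply: (C_inverse_cancel mul1x C) => //; apply: inv_sym.
have mulx1 : right_id e (@mul Q).
  move=> x; have [a ax] := inv x.
  by rewrite -ax lip // inv_sym.
have mulyy (u y : Q) : u * (y * y) = (u * y) * y.
  by have := C u y e; rewrite !mulx1.
have rip (a x u : Q) : a * x = e -> (u * a) * x = u.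
  move=> ax; have uax : ((u * a) * a) * x = u * a by rewrite -C ax mulx1.
  by rewrite -uax -mulyy -C (lip a x x ax) ax mulx1.
have invs := left_inverse_property_bijective mul1x mulx1 inv lip.
apply: (is_loop_bijective mul1x mulx1) => x; have [a [ax xa axK xaK]] := invs x.
  by exists (fun z => a * z) => z.
by exists (fun z => z * a) => z; apply: rip.
Qed.

Theorem theorem6p2 (Q : magmaType) (e : Q)
    (left_neutral : forall x : Q, e * x = x)
    (left_inverses : forall x : Q, exists x' : Q, x' * x = e)
    (identities : idLB Q \/ idM1 Q \/ idM2 Q \/ idC Q) :
  is_loop Q.
Proof.
case: identities => [LB | [M1 | [M2 | C]]].
- apply: (sandwich_is_loop left_neutral left_inverses).
    exact: LB_sandwich.
  exact: LB_regular.
- apply: (sandwich_is_loop left_neutral left_inverses).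
    exact: M1_sandwich.
  exact: M1_regular.
- exact: M2_is_loop left_neutral left_inverses M2.
- exact: C_is_loop left_neutral left_inverses C.
Qed.
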